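(* For each cardinal $\aleph$ with $\aleph_0<\aleph\le\mathfrak{c}$, the topological groups $\mathbb{C}$ and $\mathbb{R}$ each have $2^{\aleph}$ transcendental subgroups no two of which are isomorphic as topological groups or even homeomorphic. That is, for each $K\in\{\mathbb{C},\mathbb{R}\}$ there is a family of $2^{\aleph}$ transcendental groups contained in $K$ that are pairwise non-homeomorphic (and hence pairwise non-isomorphic as topological groups).
   Context: $\mathbb{C}$ and $\mathbb{R}$ denote the additive topological groups of complex and real numbers with their euclidean topologies, $\mathbb{R}\subset\mathbb{C}$. A transcendental group is a subgroup $G$ of the topological group $\mathbb{C}$ (with the subspace topology) such that every element of $G$ except $0$ is a transcendental number; a transcendental subgroup of $\mathbb{C}$ or $\mathbb{R}$ is a subgroup of it that is a transcendental group. $\mathfrak{c}$ is the cardinality of the continuum. *)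

(* Defs.v *)
From HB Require Import structures.
From mathcomp Require Import all_boot all_order all_algebra.
From mathcomp Require Import all_classical all_reals all_analysis.
From mathcomp Require Import complex.

Set Implicit Arguments.
Unset Strict Implicit.
Unset Printing Implicit Defensive.

Import Order.TTheory GRing.Theory Num.Theory.
Import numFieldNormedType.Exports.

Local Open Scope classical_set_scope.
Local Open Scope ring_scope.

(* Euclidean topology: [R[i]^o] has the topology of the modulus of [R[i]]. *)
HB.instance Definition _ (R : realType) :=
  PseudoPointedMetric.copy R[i] R[i]^o.

Definition transcendental (R : realType) (z : R[i]) : Prop :=
  ~ algebraicOver (ratr : rat -> R[i]) z.

Definition transcendental_group (R : realType) (G : set R[i]) : Prop :=
  zmod_closed (mem G) /\ forall z, G z -> z != 0 -> transcendental z.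

Definition is_homeomorphism (X Y : topologicalType) (f : X -> Y) : Prop :=
  continuous f /\ exists g : Y -> X, [/\ cancel f g, cancel g f & continuous g].

(* A set [G] of complex numbers coerces to the type [set_type G] of its
   elements, which carries the subspace topology. *)
Definition homeomorphic (R : realType) (G H : set R[i]) : Prop :=
  exists f : G -> H, is_homeomorphism f.

(* The group law of [G] is the restriction of the addition of [R[i]]; for
   subgroups, the last clause says that [f] is additive. *)
Definition topgroup_isomorphic (R : realType) (G H : set R[i]) : Prop :=
  exists2 f : G -> H, is_homeomorphism f &
    forall x y z : G, val z = val x + val y -> val (f z) = val (f x) + val (f y).

(* Main.v *)
Require Import Defs.
From HB Require Import structures.
From mathcomp Require Import all_boot all_order all_algebra.
From mathcomp Require Import all_classical all_reals all_analysis.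
From mathcomp Require Import complex.

(* It suffices to find as many groups as there are sets of sets of naturals,
   inside the reals.  Choose weights w_n decreasing so fast that an integer
   series [sum c_n w_n] with bounded coefficients, infinitely many nonzero,
   avoids a given enumeration of the algebraic reals.  Subset sums of w over an
   almost disjoint family of the size of the continuum then give reals b_t all
   of whose nontrivial integer combinations are transcendental, so distinct sets
   x of indices generate distinct transcendental groups G_x.

   A continuous map between sets of reals is determined by the rational
   intervals it maps below a given rational, so each homeomorphism class
   contains at most continuum many G_x.  A diagonal argument in the style of
   König then produces, for some code t, as many sets x as wanted whose groups
   all have code t relative to the representative of their class; two
   homeomorphic ones among them must be equal. *)

Set Implicit Arguments.
Unset Strict Implicit.
Unset Printing Implicit Defensive.

Import Order.TTheory GRing.Theory Num.Theory.
Import numFieldNormedType.Exports.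

Local Open Scope classical_set_scope.
Local Open Scope card_scope.
Local Open Scope ring_scope.

(** * Rapidly decreasing weights *)

Lemma finite_gap (R : realType) (I : finType) (F : I -> R) :
  exists2 d : R, 0 < d & forall i, F i != 0 -> d <= `|F i|.
Proof.
exists (\big[Num.min/1]_(i | F i != 0) `|F i|).
  by apply: lt_bigmin => // i; rewrite normr_gt0.
by move=> i Fi; exact: bigmin_le_cond.
Qed.

Section weights.
Variables (R : realType) (a : nat -> R).

(** Only finitely many coefficient vectors bounded by [size s] and finitely many targets [a j]
    matter, so the nonzero differences have a positive lower bound and any small enough [v] will
    do. *)
Lemma next_weight (s : seq R) : exists2 v : R, 0 < v &
  (0 < last 1 s -> 2 * v <= last 1 s) /\
  forall (c : nat -> int) (j : nat),
    (forall i, `|c i| <= (size s)%:Z) -> (j < size s)%N ->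
    let d := \sum_(i < size s) s`_i *~ c i - a j in
    d != 0 -> (2 * v) *+ size s < `|d|.
Proof.
set n := size s.
(* Coefficients in [[-n, n]] are stored as ordinals below [2n + 1], shifted by [n]. *)
pose D (p : {ffun 'I_n -> 'I_(n + n).+1} * 'I_n) : R :=
  \sum_(i < n) s`_i *~ ((p.1 i : nat)%:Z - n%:Z) - a p.2.
have [d d0 dD] := finite_gap D.
pose m : R := Num.min d (if 0 < last 1 s then last 1 s else 1).
have m0 : 0 < m by rewrite /m lt_min d0 /=; case: ifP.
(* Dividing by [n + 1] keeps [2 v n] strictly below [m], also when [n = 0]. *)
exists (m / 2 / n.+1%:R); first by rewrite !divr_gt0.
have vE : 2 * (m / 2 / n.+1%:R) = m / n.+1%:R :> R by rewrite mulrA mulrCA mulfV ?mulr1.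
rewrite vE; split.
  move=> l0; have : m <= last 1 s by rewrite /m l0 ge_min lexx orbT.
  by apply: le_trans; rewrite ler_pdivrMr// ler_peMr ?ler1n// ltW.
move=> c j cn jn e e0.
pose f := [ffun i : 'I_n => inord `|(c i + n%:Z)%R|%N : 'I_(n + n).+1].
have De : D (f, Ordinal jn) = e.
  rewrite /D /e; congr (_ - _); apply: eq_bigr => i _; congr (_ *~ _).
  have := cn i; rewrite ler_norml => /andP[c1 c2].
  have c3 : 0 <= c i + n%:Z by rewrite -lerBlDr sub0r.
  rewrite ffunE inordK; first by rewrite gez0_abs// addrK.
  by rewrite ltnS -lez_nat gez0_abs// PoszD lerD2r.
have := dD (f, Ordinal jn); rewrite De => /(_ e0) de.
apply: (@lt_le_trans _ _ m); last by apply: le_trans de; rewrite /m ge_min lexx.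
by rewrite -mulr_natr mulrAC -mulrA gtr_pMr// ltr_pdivrMr// mul1r ltr_nat.
Qed.

(* Every partial sum with small integer coefficients either equals [a j] or
   stays further from it than the whole remaining tail can reach. *)
Lemma weights : exists w : nat -> R, [/\ forall n, 0 < w n,
  forall n, 2 * w n.+1 <= w n &
  forall n (c : nat -> int) (j : nat),
    (forall i, `|c i| <= n%:Z) -> (j < n)%N ->
    let d := \sum_(i < n) w i *~ c i - a j in
    d != 0 -> (2 * w n) *+ n < `|d|].
Proof.
have /choice[next nextP] : forall s : seq R, exists v : R, 0 < v /\
  (0 < last 1 s -> 2 * v <= last 1 s) /\
  forall (c : nat -> int) (j : nat),
    (forall i, `|c i| <= (size s)%:Z) -> (j < size s)%N ->
    let d := \sum_(i < size s) s`_i *~ c i - a j in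
    d != 0 -> (2 * v) *+ size s < `|d|.
  by move=> s; have [v v0 vP] := next_weight s; exists v.
pose pre n := iter n (fun s => rcons s (next s)) [::].
pose w n := next (pre n).
have preE n : pre n = mkseq w n.
  elim: n => // n IH; rewrite /mkseq -[n.+1]addn1 iotaD map_cat cats1 -/(mkseq w n) -IH.
  by rewrite addn1.
have szE n : size (pre n) = n by rewrite preE size_mkseq.
have w0 n : 0 < w n by case: (nextP (pre n)).
exists w; split => // n.
  have [_ [+ _]] := nextP (pre n.+1).
  by rewrite -/(w n.+1) /= last_rcons; apply; exact: w0.
move=> c j cn jn; have [_ [_ /(_ c j)]] := nextP (pre n).
rewrite szE => /(_ cn jn) /=.
suff -> : \sum_(i < n) (pre n)`_i *~ c i = \sum_(i < n) w i *~ c i by [].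
by apply: eq_bigr => i _; rewrite preE nth_mkseq.
Qed.

End weights.

(** * Subset sums of the weights *)

Section subset_sums.
Variables (R : realType) (w : nat -> R).
Hypotheses (w_gt0 : forall n, 0 < w n) (w_half : forall n, 2 * w n.+1 <= w n).

Let psum (A : set nat) (n : nat) : R := \sum_(i < n) w i *+ `[< A i >].

(** The partial sums increase, while [psum A n + 2 * w n] decreases by [w_half]; the supremum of the
    former lies in between. *)
Lemma subset_sum : exists b : set nat -> R, forall A n,
  `|b A - \sum_(i < n) w i *+ `[< A i >]| <= 2 * w n.
Proof.
have psumS A n : psum A n.+1 = psum A n + w n *+ `[< A n >].
  by rewrite /psum big_ord_recr.
have w1 A n : 0 <= w n *+ `[< A n >] <= w n.
  by case: asboolP => _; rewrite ?mulr1n ?mulr0n lexx ltW.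
have psum_mono A m n : (m <= n)%N -> psum A m <= psum A n.
  elim: n => [|n IH]; first by rewrite leqn0 => /eqP->.
  rewrite leq_eqVlt => /predU1P[->//|/IH /le_trans]; apply.
  by rewrite psumS lerDl; case/andP: (w1 A n).
have psum_anti A m n : (m <= n)%N -> psum A n + 2 * w n <= psum A m + 2 * w m.
  elim: n => [|n IH]; first by rewrite leqn0 => /eqP->.
  rewrite leq_eqVlt => /predU1P[->//|/IH]; apply: le_trans.
  rewrite psumS -addrA lerD2l [leRHS]mulr_natl mulr2n lerD//.
  by case/andP: (w1 A n).
have psum_ub A m n : psum A m <= psum A n + 2 * w n.
  have [mn|/ltnW nm] := leqP m n.
    by rewrite (le_trans (psum_mono A _ _ mn))// lerDl mulr_ge0// ltW.
  by apply: le_trans (psum_anti A _ _ nm); rewrite lerDl mulr_ge0// ltW.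
exists (fun A => sup (range (psum A))) => A n.
have hs : has_sup (range (psum A)).
  split; first by exists (psum A 0), 0.
  by exists (psum A 0 + 2 * w 0) => _ [m _ <-]; exact: psum_ub.
rewrite ger0_norm ?lerBlDl ?subr_ge0.
  by apply: ge_sup; [case: hs|move=> _ [m _ <-]; exact: psum_ub].
by apply: ub_le_sup; [case: hs|exists n].
Qed.

End subset_sums.

(** * Almost disjoint sets of naturals *)

Lemma injective_unbounded (f : nat -> nat) : injective f ->
  forall N M, exists2 m, (M <= m)%N & (N <= f m)%N.
Proof.
move=> f_inj N M; apply: contrapT => noN.
have lt m : (M <= m)%N -> (f m < N)%N.
  by move=> Mm; rewrite ltnNge; apply/negP => Nm; apply: noN; exists m.
have : (size (map f (iota M N.+1)) <= size (iota 0 N))%N.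
  apply: uniq_leq_size; first by rewrite map_inj_uniq// iota_uniq.
  by move=> _ /mapP[m + ->]; rewrite !mem_iota => /andP[/lt].
by rewrite size_map !size_iota ltnn.
Qed.

(* [A t] is the branch of [t] in the binary tree, so distinct [A t]'s have
   finite intersections. *)
Lemma almost_disjoint_family : exists A : set nat -> set nat,
  forall t (s : seq (set nat)) N, exists n, [/\ (N <= n)%N, A t n &
    forall t', t' \in s -> A t' n -> t' = t].
Proof.
pose code (t : set nat) m := pickle (mkseq (fun i => `[< t i >]) m).
have codeP t t' m m' : code t m = code t' m' ->
    m = m' /\ forall i, (i < m)%N -> t i = t' i.
  move/(pcan_inj pickleK) => e.
  have mE : m = m' by move/(congr1 size): e; rewrite !size_mkseq.
  split=> // i im; apply/propext.
  move/(congr1 (fun r => nth false r i)): e; rewrite !nth_mkseq -?mE//.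
  by move=> e; split=> /asboolP; [rewrite e|rewrite -e] => /asboolP.
exists (fun t => range (code t)) => t s N.
(* [D t'] is a place where [t'] differs from [t]; a node of [t] longer than all of these lies on the
   branch of no other member of [s]. *)
have /choice[D DP] : forall t', exists i, t' <> t -> t' i <> t i.
  move=> t'; apply: contrapT => /forallNP H.
  have /not_implyP[] := H 0 => t't _; apply: t't; apply/funext => i.
  by have /not_implyP[_ /contrapT] := H i.
have [|m Mm Nm] := @injective_unbounded (code t) _ N (\max_(t' <- s) D t').+1.
  by move=> m m' /codeP[].
exists (code t m); split=> //.
move=> t' t's [m' _ /codeP[m'm tt']]; apply: contrapT => /DP; apply.
by apply: tt'; rewrite m'm (leq_ltn_trans _ Mm)// leq_bigmax_seq.
Qed.

(** * Integer combinations avoiding the algebraic reals *)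

Section independent.
Variables (R : realType) (a : nat -> R).

(** If the combination were [a j], the gaps would make its partial sums in the weights eventually
    equal to [a j], so its coefficients would eventually vanish; yet arbitrarily far out on the
    branch of [t] the coefficient is the nonzero total at [t]. *)
Lemma independent_family : exists b : set nat -> R,
  forall (s : seq (set nat * int)) t, \sum_(p <- s | p.1 == t) p.2 != 0 ->
    forall j, \sum_(p <- s) b p.1 *~ p.2 != a j.
Proof.
have [w [w0 w_half w_gap]] := weights a.
have [b bP] := subset_sum w0 w_half.
have [A AP] := almost_disjoint_family.
exists (b \o A) => s t mass0 j; apply/eqP => /= xE.
pose c n : int := \sum_(p <- s) p.2 *+ `[< A p.1 n >].
pose K : nat := \sum_(p <- s) `|p.2|%N.
have cK n : `|c n| <= K%:Z.
  rewrite (le_trans (ler_norm_sum _ _ _))// /K -natz natr_sum.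
  apply: ler_sum => p _; rewrite natz abszE.
  by case: asboolP => _; rewrite ?mulr1n ?mulr0n ?normr0.
pose S n := \sum_(i < n) w i *~ c i.
have SP n : `|a j - S n| <= (2 * w n) *+ K.
  have -> : S n = \sum_(p <- s) (\sum_(i < n) w i *+ `[< A p.1 i >]) *~ p.2.
    rewrite /S; under eq_bigr do rewrite /c mulrz_sumr.
    rewrite exchange_big; apply: eq_bigr => p _.
    by rewrite mulrz_suml; apply: eq_bigr => i _; case: asboolP; rewrite ?mul0rz.
  rewrite -xE -sumrB (le_trans (ler_norm_sum _ _ _))// /K -sumrMnr ler_sum// => p _.
  by rewrite -mulrzBl normrMz -abszE -pmulrn lerMn2r bP orbT.
(* Once [n] exceeds [K], a nonzero difference would be larger than the tail bound [SP] allows. *)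
have S_eq n : (maxn K j < n)%N -> S n = a j.
  rewrite gtn_max => /andP[Kn jn]; apply/eqP; rewrite -subr_eq0.
  apply: contraT => /w_gap; move/(_ _ jn) => gap.
  have : (2 * w n) *+ n < `|S n - a j|.
    by apply: gap => i; rewrite (le_trans (cK i))// lez_nat ltnW.
  rewrite distrC => /lt_le_trans/(_ (SP n)); rewrite ltNge => /negP[].
  by rewrite ler_wpMn2l ?mulr_ge0 ?(ltW (w0 n))// ltnW.
have [n [nN Atn nP]] := AP t (map fst s) (maxn K j).+1.
have cn : c n = \sum_(p <- s | p.1 == t) p.2.
  rewrite /c [RHS]big_mkcond big_seq [RHS]big_seq; apply: eq_bigr => p ps.
  case: eqP => [->|pt]; first by rewrite asboolT.
  by rewrite asboolF// => /(nP _ (map_f fst ps)).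

(* Both [S n] and [S n.+1] equal [a j], so the term [w n *~ c n] between them is zero. *)
have := S_eq n.+1 (leqW nN); rewrite /S big_ord_recr /= -/(S n) S_eq//.
move/eqP; rewrite -subr_eq0 addrAC subrr add0r cn.
by rewrite mulrz_eq0 (negPf mass0) gt_eqF.
Qed.

End independent.

(** An algebraic number is given by a rational polynomial and a position in its list of roots, and
    such pairs are countable. *)
Lemma algebraic_real_enum (R : realType) : exists a : nat -> R,
  forall x : R, ~ transcendental (real_complex R x) -> exists j, x = a j.
Proof.
have /choice[rs rsP] : forall p : {poly rat}, exists r : seq R[i],
    p != 0 -> forall z, root (map_poly (ratr : rat -> R[i]) p) z -> z \in r.
  move=> p; have [r rE] := closed_field_poly_normal (map_poly (ratr : rat -> R[i]) p).
  exists r => p0 z; rewrite rE rootZ ?root_prod_XsubC//.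
  by rewrite lead_coef_eq0 map_poly_eq0.
exists (fun n => if unpickle n is Some (p, i) then complex.Re (nth 0 (rs p) i) else 0).
move=> x /contrapT[p p0 /(rsP _ p0) xp].
by exists (pickle (p, index x%:C%C (rs p))); rewrite pickleK nth_index.
Qed.

(** * Groups of integer combinations *)

Section spans.
Variables (R : realType) (b : set nat -> R).

(** The subgroup generated by the [b t] with [t] in [x]. Formal sums may repeat an index, so that
    concatenating lists adds them. *)
Definition int_span (x : set (set nat)) : set R[i] :=
  [set real_complex R (\sum_(p <- s) b p.1 *~ p.2) |
    s in [set s : seq (set nat * int) | forall p, p \in s -> x p.1]].

Lemma int_span_real x : int_span x `<=` range (real_complex R).
Proof. by move=> _ [s _ <-]; exists (\sum_(p <- s) b p.1 *~ p.2). Qed.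

Lemma int_span_gen (x : set (set nat)) t : x t -> int_span x (real_complex R (b t)).
Proof.
move=> xt; exists [:: (t, 1)]; last by rewrite big_seq1.
by move=> p; rewrite inE => /eqP->.
Qed.

Lemma int_span_zmod x : zmod_closed (mem (int_span x)).
Proof.
split; first by apply/mem_set; exists [::] => //; rewrite big_nil.
move=> _ _ /set_mem[s sx <-] /set_mem[r rx <-]; apply/mem_set.
exists (s ++ [seq (p.1, - p.2) | p <- r]).
  move=> p; rewrite mem_cat => /orP[/sx//|/mapP[q /rx ? ->]//].
rewrite big_cat big_map /= -rmorphB; congr (real_complex R _); congr (_ + _).
by rewrite -sumrN; apply: eq_bigr => p _; rewrite mulrNz.
Qed.

(** Collecting repeated indices shows that a nonzero combination has a nonzero total coefficient
    somewhere, as [b_indep] requires. *)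
Lemma sum_by_mass (s : seq (set nat * int)) :
  \sum_(p <- s) b p.1 *~ p.2 =
  \sum_(t <- undup (map fst s)) b t *~ \sum_(p <- s | p.1 == t) p.2.
Proof.
under [RHS]eq_bigr do rewrite big_mkcond mulrz_sumr.
rewrite exchange_big [LHS]big_seq [RHS]big_seq; apply: eq_bigr => p ps.
rewrite (bigD1_seq p.1) ?undup_uniq ?mem_undup ?map_f//= eqxx big1 ?addr0//.
by move=> t /negPf; rewrite eq_sym => ->.
Qed.

Hypothesis b_indep : forall (s : seq (set nat * int)) t,
  \sum_(p <- s | p.1 == t) p.2 != 0 ->
  transcendental (real_complex R (\sum_(p <- s) b p.1 *~ p.2)).

Lemma int_span_transcendental x : transcendental_group (int_span x).
Proof.
split; first exact: int_span_zmod.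
move=> _ [s _ <-] s0.
have [[t /b_indep//]|mass0] := pselect (exists t, \sum_(p <- s | p.1 == t) p.2 != 0).
case/negP: s0; rewrite sum_by_mass big1// => t _.
case: (eqVneq (\sum_(p <- s | p.1 == t) p.2) 0) => [->//|ne].
by case: mass0; exists t.
Qed.

(** If [b t] were a combination over a set without [t], subtracting would give a formal sum with
    total coefficient 1 at [t] and value 0, which is algebraic. *)
Lemma int_span_inj : injective int_span.
Proof.
suff sub x y : int_span x = int_span y -> x `<=` y.
  by move=> x y e; apply/seteqP; split; apply: sub.
move=> e t /int_span_gen; rewrite e => -[s sy /complexI sE].
apply: contrapT => yt.
have := @b_indep ((t, 1) :: [seq (p.1, - p.2) | p <- s]) t.
rewrite !big_cons big_map /= eqxx big_map /=.
rewrite [X in 1 + X]big_seq_cond big1 => [|p /andP[/sy yp /eqP pt]]; last first.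
  by rewrite pt in yp.
under eq_bigr do rewrite mulrNz.
rewrite sumrN sE mulr1z subrr rmorph0 => /(_ isT); apply.
exact: algebraic0.
Qed.

End spans.

(** * Homeomorphisms between sets of reals and their codes *)

Section homeomorphic.
Variable R : realType.
Implicit Types G H K : set R[i].

Lemma normc_real (x : R) : `|real_complex R x| = real_complex R `|x|.
Proof. by rewrite normc_def /= expr0n addr0 sqrtr_sqr. Qed.

Lemma homeomorphic_refl G : homeomorphic G G.
Proof. by exists id; split; [|exists id; split] => //; move=> x; exact: cvg_id. Qed.

Lemma homeomorphic_sym G H : homeomorphic G H -> homeomorphic H G.
Proof. by move=> [f [fc [g [fg gf gc]]]]; exists g; split=> //; exists f. Qed.

Lemma homeomorphic_trans G H K :
  homeomorphic G H -> homeomorphic H K -> homeomorphic G K.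
Proof.
move=> [f [fc [g [fg gf gc]]]] [f' [fc' [g' [fg' gf' gc']]]].
exists (f' \o f); split; first by move=> x; apply: continuous_comp; [exact: fc|exact: fc'].
exists (g \o g'); split; first exact: can_comp.
  exact: can_comp.
by move=> x; apply: continuous_comp; [exact: gc'|exact: gc].
Qed.

(** Homeomorphic sets have the same class [cls] as a set, so [get] returns the very same
    representative for both. *)
Lemma homeomorphic_representative : exists rep : set R[i] -> set R[i],
  forall G, G `<=` range (real_complex R) ->
    [/\ rep G `<=` range (real_complex R), homeomorphic (rep G) G &
        forall H, homeomorphic G H -> rep G = rep H].
Proof.
pose cls G := [set H | H `<=` range (real_complex R) /\ homeomorphic H G].
exists (fun G => get (cls G)) => G Greal.
have [rreal rG] : cls G (get (cls G)).
  by apply: getPex; exists G; split=> //; exact: homeomorphic_refl.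
split=> // H GH; congr get; apply/seteqP; split=> K [Kreal KG]; split=> //.
  exact: homeomorphic_trans KG GH.
exact: homeomorphic_trans KG (homeomorphic_sym GH).
Qed.

(** Rational triples keep the index type countable, so that a code becomes a set of naturals. *)
Definition below_code G H (f : G -> H) : set (rat * rat * rat) :=
  [set u | forall g : G, ratr u.1.1 < complex.Re (val g) < ratr u.1.2 ->
    complex.Re (val (f g)) < ratr u.2].

Lemma continuous_below G H (f : G -> H) (g : G) (r : R) :
  G `<=` range (real_complex R) -> continuous f ->
  complex.Re (val (f g)) < r ->
  exists2 e : R, 0 < e & forall g' : G,
    `|complex.Re (val g) - complex.Re (val g')| < e -> complex.Re (val (f g')) < r.
Proof.
move=> Greal fc fr.
pose d := r - complex.Re (val (f g)).
have d0 : 0 < d by rewrite subr_gt0.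
pose U : set H := set_val @^-1` ball (val (f g)) (real_complex R d).
have nU : nbhs (f g) U.
  rewrite nbhsE; exists (set_val @^-1` (ball (val (f g)) (real_complex R d))^°).
    split; first by exists (ball (val (f g)) (real_complex R d))^° => //; exact: open_interior.
    by apply: nbhsx_ballx; rewrite ltcR.
  by move=> h /interior_subset.
have [_ [[W oW <-] /= Wg WU]] := fc g _ nU.
have /nbhs_ballP[e e0 eW] : nbhs (val g) W by exact: open_nbhs_nbhs.
(* A positive radius in [R[i]] has zero imaginary part, so its real part serves as the real
   radius. *)
move: e0; rewrite /= ltcE /= => /andP[/eqP eI eR].
exists (complex.Re e) => // g' gg'.
have /WU : (set_val @^-1` W) g'.
  apply: eW; rewrite /ball /=.
  have [[x _ xE] [y _ yE]] := (Greal _ (set_valP g), Greal _ (set_valP g')).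
  move: xE yE gg'; rewrite !set_valE /= => <- <-; rewrite -rmorphB normc_real /= => xy.
  by rewrite ltcE /= eI eqxx.
rewrite /U /= /ball /= distrC => /(le_lt_trans (normc_ge_Re _)).
rewrite ltcR raddfB /= => /(le_lt_trans (ler_norm _)).
by rewrite /d ltrD2r.
Qed.

(** For a rational [r] between [f g] and a larger [f' g], continuity gives a rational interval
    around [g] that [f] maps below [r], while [f'] does not. *)
Lemma below_code_le G H H' (f : G -> H) (f' : G -> H') :
  G `<=` range (real_complex R) -> continuous f ->
  below_code f `<=` below_code f' ->
  forall g, complex.Re (val (f' g)) <= complex.Re (val (f g)).
Proof.
move=> Greal fc sub g; rewrite leNgt; apply/negP => lt.
have [r] := rat_in_itvoo lt; rewrite in_itv /= => /andP[fr rf'].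
have [e e0 eP] := continuous_below Greal fc fr.
have [p] : exists q : rat, ratr q \in `]complex.Re (val g) - e, complex.Re (val g)[.
  by apply: rat_in_itvoo; rewrite gtrBl.
have [q] : exists q : rat, ratr q \in `]complex.Re (val g), complex.Re (val g) + e[.
  by apply: rat_in_itvoo; rewrite ltrDl.
rewrite !in_itv /= => /andP[gq qe] /andP[ep pg].
have /sub/(_ g) : below_code f (p, q, r).
  move=> g' /andP[/= pg' g'q]; apply: eP; rewrite ltr_distlC.
  by rewrite (lt_trans ep)//= (lt_trans g'q).
by rewrite /= pg gq => /(_ isT) /(lt_trans rf'); rewrite ltxx.
Qed.

(* Since [f] is onto, its code determines its target. *)
Lemma below_code_inj G H H' (f : G -> H) (f' : G -> H') :
  G `<=` range (real_complex R) ->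
  H `<=` range (real_complex R) -> H' `<=` range (real_complex R) ->
  is_homeomorphism f -> is_homeomorphism f' ->
  below_code f = below_code f' -> H = H'.
Proof.
move=> Greal Hreal H'real [fc [k [_ kK _]]] [f'c [k' [_ k'K _]]] e.
have le1 : forall g, complex.Re (val (f' g)) <= complex.Re (val (f g)).
  by apply: below_code_le Greal fc _; rewrite e.
have le2 : forall g, complex.Re (val (f g)) <= complex.Re (val (f' g)).
  by apply: below_code_le Greal f'c _; rewrite e.
have ff' g : val (f g) = val (f' g).
  have [x _ xE] := Hreal _ (set_valP (f g)).
  have [y _ yE] := H'real _ (set_valP (f' g)).
  rewrite -xE -yE; congr (real_complex R _); apply/eqP; rewrite eq_le.
  by have := le1 g; have := le2 g; rewrite -xE -yE /= => -> ->.
apply/seteqP; split=> z Hz.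
  have <- : val (f (k (SigSub (mem_set Hz)))) = z by rewrite kK.
  by rewrite ff'; exact: set_valP.
have <- : val (f' (k' (SigSub (mem_set Hz)))) = z by rewrite k'K.
by rewrite -ff'; exact: set_valP.
Qed.

End homeomorphic.

(** * Coding by sets of naturals and the diagonal argument *)

Lemma pickle_image_inj (I : countType) : injective (fun A : set I => pickle @` A).
Proof.
move=> A B AB; apply/seteqP; split=> i Ai; have := imageP pickle Ai.
  by rewrite AB (image_inj (pcan_inj pickleK)).
by rewrite -AB (image_inj (pcan_inj pickleK)).
Qed.

Lemma real_inj_set_nat (R : realType) : exists f : R -> set nat, injective f.
Proof.
exists (fun r => pickle @` [set q : rat | ratr q < r]) => r r' /pickle_image_inj e.
wlog lt : r r' e / r < r'.
  by move=> H; have [/H->|/H->|//] := ltgtP r r'.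
have [q] := rat_in_itvoo lt; rewrite in_itv /= => /andP[rq qr'].
have : [set q : rat | ratr q < r'] q by [].
by rewrite -e /= => /(lt_trans rq); rewrite ltxx.
Qed.

(* König's diagonal argument, with [set nat] identified with its square. *)
Lemma konig_diagonal (c : set (set nat) -> set nat) :
  exists (t : set nat) (x : set (set nat) -> set (set nat)),
    injective x /\ forall s, c (x s) = t.
Proof.
pose pair (t u : set nat) : set nat :=
  pickle @` [set p : bool * nat | (if p.1 then t else u) p.2].
have pair_inj t u t' u' : pair t u = pair t' u' -> t = t' /\ u = u'.
  move/pickle_image_inj => e; split; apply/funext => n.
    by have := congr1 (@^~ (true, n)) e.
  by have := congr1 (@^~ (false, n)) e.
pose slice t (x : set (set nat)) := [set u | x (pair t u)].
(* Otherwise each [t] has a slice [d t] missed by all sets of code [t]; the set whose slice at every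
   [t] is [d t] contradicts this at its own code. *)
have [t tP] : exists t, forall s, exists x, c x = t /\ slice t x = s.
  apply: contrapT => /forallNP H.
  have /choice[d dP] : forall t, exists s, forall x, c x = t -> slice t x <> s.
    move=> t; have /existsNP[s sP] := H t.
    by exists s => x cx xs; apply: sP; exists x.
  pose x := [set v | exists t u, d t u /\ v = pair t u].
  apply: (dP (c x) x erefl); apply/seteqP; split=> u.
    by move=> [t [u' [du /pair_inj[-> ->]]]].
  by move=> du; exists (c x), u.
have [x xP] := choice tP; exists t, x; split=> [s s' e|s]; last by case: (xP s).
by rewrite -(xP s).2 e (xP s').2.
Qed.

(** * The family indexed by the subsets of [aleph] *)

Theorem theorem4p12 (R : realType) (aleph : Type)
    (aleph_uncountable : [set: nat] #<= [set: aleph] /\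
                         [set: nat] #!= [set: aleph])
    (aleph_le_continuum : [set: aleph] #<= [set: R])
    (K : set R[i]) (hK : K = [set: R[i]] \/ K = range (real_complex R)) :
  exists F : set (set R[i]),
    [/\ F #= [set: set aleph],
        forall G, F G -> transcendental_group G /\ G `<=` K &
        forall G H, F G -> F H -> G <> H ->
          ~ topgroup_isomorphic G H /\ ~ homeomorphic G H].
Proof.
have [a aP] := algebraic_real_enum R.
have [b bP] := independent_family a.
have b_indep (s : seq (set nat * int)) t : \sum_(p <- s | p.1 == t) p.2 != 0 ->
    transcendental (real_complex R (\sum_(p <- s) b p.1 *~ p.2)).
  move=> mass0; apply: contrapT => /aP[j xE].
  by have := bP s t mass0 j; rewrite xE eqxx.
have [rep repP] := @homeomorphic_representative R.
have /choice[c cP] : forall x : set (set nat), exists u : set nat,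
    exists f : rep (int_span b x) -> int_span b x,
    is_homeomorphism f /\ u = pickle @` below_code f.
  move=> x; have [_ [f fP] _] := repP _ (@int_span_real R b x).
  by exists (pickle @` below_code f), f.
have [t [x [x_inj xt]]] := konig_diagonal c.
(* Both groups are images of one representative under homeomorphisms with the same code [t], so they
   coincide. *)
have G_inj s s' : homeomorphic (int_span b (x s)) (int_span b (x s')) -> s = s'.
  move=> ss'; apply/x_inj/(int_span_inj b_indep).
  have [rreal _ /(_ _ ss') repE] := repP _ (@int_span_real R b (x s)).
  have := cP (x s'); have := cP (x s); rewrite !xt -repE.
  move=> [f [f_homeo ->]] [f' [f'_homeo /pickle_image_inj]].
  by apply: below_code_inj => //; exact: int_span_real.
have [h h_inj] : exists h : aleph -> set nat, injective h.
  have [f f_inj] := real_inj_set_nat R.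
  have /pcard_leTP[g] := aleph_le_continuum.
  exists (f \o g); apply: inj_comp => //; exact: inj.
pose G (A : set aleph) := int_span b (x (h @` A)).
have G_inj' A B : homeomorphic (G A) (G B) -> A = B.
  move/G_inj => AB; apply/seteqP; split=> i Ai; have := imageP h Ai.
    by rewrite AB image_inj.
  by rewrite -AB image_inj.
exists (range G); split.
- apply: inj_card_eq => A B _ _ AB; apply: G_inj'; rewrite AB.
  exact: homeomorphic_refl.
- move=> _ [A _ <-]; split; first exact: int_span_transcendental.
  by case: hK => -> // ; exact: int_span_real.
- move=> _ _ [A _ <-] [B _ <-] AB.
  have nAB : ~ homeomorphic (G A) (G B) by move=> /G_inj' e; apply: AB; rewrite e.
  by split=> // -[f f_homeo _]; apply: nAB; exists f.
Qed.
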